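(* Let $\mu$ be a connected self-join-free conjunctive query over a finite binary signature $\tau$. If $\mathrm{multigr}(\mu)$ contains a cycle of length $\geq3$, then $\Delta_\mu$ pp-constructs $(\{0,1\};\mathrm{OIT})$, where $\mathrm{OIT}=\{(0,0,1),(0,1,0),(1,0,0)\}$.
   Context: A binary signature consists only of binary relation symbols. A conjunctive query is a primitive positive sentence; it is connected if its canonical database (domain = variables, tuples = atoms) is not a disjoint union of two nonempty structures, and self-join-free if each relation symbol occurs at most once. $\mathrm{multigr}(\mu)$ is the undirected multigraph on the variables of $\mu$ whose edge multiset is the multiset union of all relations of the canonical database. A cycle of length $k$ in it is a sequence $v_0,\dots,v_k$ with $v_k=v_0$, $v_i,v_{i+1}$ joined by an edge for each $i$, and $v_0,\dots,v_{k-1}$ pairwise distinct (using distinct edges as in an oriented cycle). Duals: a dual of $\mu$ is a relational structure to which a finite structure maps homomorphically iff it does not satisfy $\mu$. A relational structure with oligomorphic automorphism group is a model-complete core if its endomorphisms are exactly the closure of its automorphism group in the pointwise convergence topology. $\mathfrak C_\mu$ is the model-complete core (unique up to isomorphism) homomorphically equivalent to a countable dual of $\mu$ with oligomorphic automorphism group; $\Delta_\mu$ is the valued structure on its domain whose relations take value $0$ on tuples of the corresponding relation of $\mathfrak C_\mu$ and $1$ otherwise. pp-constructions: valued relations are maps $C^k\to\mathbb Q\cup\{\infty\}$; relational structures are $\{0,\infty\}$-valued. $\langle\Gamma\rangle$ is the smallest set of valued relations containing those of $\Gamma$, crisp equality and the empty unary relation, closed under sums of atomic expressions, projection by infimum,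 rational shifting, nonnegative rational scaling, $\mathrm{Feas}$ and $\mathrm{Opt}$ (feasible tuples of minimal value). A $d$-th pp-power of $\Gamma$ has domain $C^d$ with relations obtained from $kd$-ary relations of $\langle\Gamma\rangle$ by grouping arguments into blocks of $d$. A fractional homomorphism from $\Delta$ (domain $D$) to $\Gamma$ is a probability measure $\omega$ on Borel sets of $C^D$ (pointwise convergence topology) with $E_\omega[g\mapsto S^\Gamma(g(t))]\le S^\Delta(t)$ for all symbols and tuples. $\Gamma$ pp-constructs $\Delta$ if $\Delta$ is fractionally homomorphically equivalent to a pp-power of $\Gamma$. *)

(* Defs.v *)
From HB Require Import structures.
From mathcomp Require Import all_boot all_order all_algebra.
From mathcomp Require Import all_classical all_reals all_analysis.
Set Implicit Arguments.
Unset Strict Implicit.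
Unset Printing Implicit Defensive.
Import Order.TTheory GRing.Theory Num.Theory.
Local Open Scope classical_set_scope.
Local Open Scope ring_scope.

(** * Structures over a binary signature *)

Definition structure (tau D : Type) := tau -> D -> D -> Prop.

Section Structures.
Variable tau : Type.

Definition is_hom (A B : Type) (rA : structure tau A) (rB : structure tau B)
    (h : A -> B) : Prop :=
  forall s x y, rA s x y -> rB s (h x) (h y).

Definition is_iso (A B : Type) (rA : structure tau A) (rB : structure tau B)
    (h : A -> B) : Prop :=
  bijective h /\ (forall s x y, rA s x y <-> rB s (h x) (h y)).

Definition hom_equiv (A B : Type) (rA : structure tau A)
    (rB : structure tau B) : Prop :=
  (exists h, is_hom rA rB h) /\ (exists h, is_hom rB rA h).

Definition disjoint_union (A B : Type) (rA : structure tau A)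
    (rB : structure tau B) : structure tau (A + B) :=
  fun s x y => match x, y with
    | inl a, inl a' => rA s a a'
    | inr b, inr b' => rB s b b'
    | _, _ => False
    end.

Definition connected_structure (D : Type) (rD : structure tau D) : Prop :=
  ~ exists (A B : Type) (rA : structure tau A) (rB : structure tau B),
    [/\ inhabited A, inhabited B
      & exists h, is_iso rD (disjoint_union rA rB) h].

Definition endomorphisms (D : Type) (rD : structure tau D) : set (D -> D) :=
  [set f | is_hom rD rD f].

Definition automorphisms (D : Type) (rD : structure tau D) : set (D -> D) :=
  [set f | is_iso rD rD f].

Definition orbit_of_tuple (D : Type) (rD : structure tau D) (n : nat)
    (t : 'I_n -> D) : set ('I_n -> D) :=
  [set f \o t | f in automorphisms rD].

Definition oligomorphic (D : Type) (rD : structure tau D) : Prop :=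
  forall n, finite_set (range (@orbit_of_tuple D rD n)).

(* The closure is taken in D^D with D discrete. *)
Definition model_complete_core (D : choiceType) (rD : structure tau D) : Prop :=
  oligomorphic rD /\
  endomorphisms rD =
    closure (automorphisms rD : set {ptws D -> discrete_topology D}).

End Structures.

(** * Conjunctive queries *)

(* The atom s(x, y) is encoded as (s, x, y).  The atoms form a sequence, so
   that repeated occurrences of a symbol are recorded. *)
Record conj_query (tau : finType) := ConjQuery {
  cq_var : finType;
  cq_atoms : seq (tau * cq_var * cq_var) }.

Section Queries.
Variables (tau : finType) (mu : conj_query tau).

Definition satisfies (A : Type) (rA : structure tau A) : Prop :=
  exists h : cq_var mu -> A,
    forall s x y, (s, x, y) \in cq_atoms mu -> rA s (h x) (h y).

Definition canonical_db : structure tau (cq_var mu) :=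
  fun s x y => (s, x, y) \in cq_atoms mu.

Definition cq_connected : Prop := connected_structure canonical_db.

Definition self_join_free : Prop := uniq [seq a.1.1 | a <- cq_atoms mu].

Definition is_dual (D : Type) (rD : structure tau D) : Prop :=
  forall (A : finType) (rA : structure tau A),
    (exists h, is_hom rA rD h) <-> ~ satisfies rA.

(* (C, rC) is a copy of the structure C_mu, which is determined up to
   isomorphism. *)
Definition is_C_mu (C : choiceType) (rC : structure tau C) : Prop :=
  [/\ countable [set: C], model_complete_core rC
    & exists (D : Type) (rD : structure tau D),
        [/\ countable [set: D], oligomorphic rD, is_dual rD
          & hom_equiv rC rD]].

End Queries.

(* [mg_ends e] is the set of endpoints of e, a singleton if e is a loop. *)
Record multigraph := Multigraph {
  mg_vertex : finType;
  mg_edge : finType;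
  mg_ends : mg_edge -> {set mg_vertex} }.

(* The elements of [seq_sub (cq_atoms mu)] are the tuples of the relations of
   the canonical database, tagged with their relation symbol. *)
Definition multigr (tau : finType) (mu : conj_query tau) : multigraph :=
  @Multigraph (cq_var mu) (seq_sub (cq_atoms mu))
    (fun e => finset.setU (finset.set1 (ssval e).1.2)
                          (finset.set1 (ssval e).2)).

Definition has_cycle (G : multigraph) (k : nat) : Prop :=
  exists (v : nat -> mg_vertex G) (e : nat -> mg_edge G),
    [/\ v k = v 0%N,
        {in gtn k &, injective v},
        {in gtn k &, injective e}
      & forall i, (i < k)%N ->
          mg_ends (e i) =
            finset.setU (finset.set1 (v i)) (finset.set1 (v i.+1))].

(** * Valued structures *)

(* Valued relations take values in Q u {oo}.  They are represented by functions
   to [\bar rat] that avoid -oo. *)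
Definition valued_rel (C : Type) (k : nat) := ('I_k -> C) -> \bar rat.

Record signature := Signature { symbol : Type; arity : symbol -> nat }.

Record valued_structure (sg : signature) (C : Type) := ValuedStructure {
  vrel : forall s : symbol sg, valued_rel C (arity s);
  vrel_neqNy : forall s (t : 'I_(arity s) -> C), @vrel s t != -oo%E }.
Arguments vrel {sg C} v s.

Definition crisp (P : Prop) : \bar rat := if `[< P >] then 0%E else +oo%E.

Lemma crisp_neqNy P : crisp P != -oo%E.
Proof. by rewrite /crisp; case: ifP. Qed.

Definition cat_tuple_fun (C : Type) (k m : nat) (x : 'I_k -> C)
    (y : 'I_m -> C) : 'I_(k + m) -> C :=
  fun i => match fintype.split i with inl a => x a | inr b => y b end.

Section Expressible.
Local Open Scope ereal_scope.
Variables (sg : signature) (C : Type) (Gamma : valued_structure sg C).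

(* In [ex_scale], 0 * oo = 0; the convention 0 * oo = oo would yield the same
   set, in view of [ex_sum] and [ex_feas]. *)
Inductive expressible : forall k, valued_rel C k -> Prop :=
| ex_rel (s : symbol sg) : expressible (vrel Gamma s)
| ex_eq : @expressible 2 (fun t => crisp (t ord0 = t ord_max))
| ex_empty : @expressible 1 (fun=> +oo)
| ex_sum (k m : nat) (l : 'I_m -> nat) (S : forall j, valued_rel C (l j))
    (v : forall j, 'I_(l j) -> 'I_k) :
    (forall j, expressible (S j)) ->
    @expressible k (fun t => \sum_(j < m) S j (t \o v j))
| ex_proj (k m : nat) (S : valued_rel C (k + m)) (S' : valued_rel C k) :
    expressible S ->
    (forall x, S' x != -oo /\
       infimums (range (fun y => S (cat_tuple_fun x y))) (S' x)) ->
    expressible S'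
| ex_shift (k : nat) (S : valued_rel C k) (q : rat) :
    expressible S -> @expressible k (fun t => S t + q%:E)
| ex_scale (k : nat) (S : valued_rel C k) (q : rat) :
    (0 <= q)%R -> expressible S -> @expressible k (fun t => q%:E * S t)
| ex_feas (k : nat) (S : valued_rel C k) :
    expressible S -> @expressible k (fun t => crisp (S t < +oo))
| ex_opt (k : nat) (S : valued_rel C k) :
    expressible S ->
    @expressible k (fun t => crisp (S t < +oo /\ forall u, S t <= S u)).

End Expressible.

Lemma block_row_subproof k d (i : 'I_(k * d)) : (i %/ d < k)%N.
Proof. by rewrite ltn_divLR //; case: d i => [|//] [i]; rewrite muln0. Qed.

Lemma block_col_subproof k d (i : 'I_(k * d)) : (i %% d < d)%N.
Proof. by rewrite ltn_mod; case: d i => [|//] [i]; rewrite muln0. Qed.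

(* The concatenation of k blocks of length d. *)
Definition flatten_blocks (C : Type) (k d : nat) (t : 'I_k -> 'I_d -> C) :
    'I_(k * d) -> C :=
  fun i => t (Ordinal (block_row_subproof i)) (Ordinal (block_col_subproof i)).

Definition is_pp_power (sg sg' : signature) (C : Type) (d : nat)
    (Gamma : valued_structure sg C)
    (P : valued_structure sg' ('I_d -> C)) : Prop :=
  forall s : symbol sg', exists S : valued_rel C (arity s * d),
    expressible Gamma S /\ forall t, vrel P s t = S (flatten_blocks t).

(** * Fractional homomorphisms *)

(* C^D, for C discrete, with the Borel sigma-algebra of the topology of
   pointwise convergence. *)
Definition borel_maps (D : Type) (C : pointedType) :=
  g_sigma_algebraType
    (@open {ptws D -> discrete_topology C} : set (set (D -> C))).

Section Expectation.
Local Open Scope ereal_scope.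
Variables (d : measure_display) (T : measurableType d) (R : realType).
Variables (w : probability T R) (X : T -> \bar R).

(* [\int] is total: it has a junk value when both the positive and the negative
   parts of the integrand have infinite integral. *)
Definition expectation_exists : Prop :=
  \int[w]_g X^\+ g < +oo \/ \int[w]_g X^\- g < +oo.

End Expectation.

Definition is_frac_hom (R : realType) (sg : signature) (D : Type)
    (C : pointedType) (Delta : valued_structure sg D)
    (Gamma : valued_structure sg C)
    (w : probability (borel_maps D C) R) : Prop :=
  forall (s : symbol sg) (t : 'I_(arity s) -> D),
    let X := fun g : borel_maps D C => er_map ratr (vrel Gamma s (g \o t)) in
    expectation_exists w X /\
    (\int[w]_g X g <= er_map ratr (vrel Delta s t))%E.

Definition frac_hom_equiv (R : realType) (sg : signature) (D C : pointedType)
    (Delta : valued_structure sg D) (Gamma : valued_structure sg C) : Prop :=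
  (exists w, @is_frac_hom R sg D C Delta Gamma w) /\
  (exists w, @is_frac_hom R sg C D Gamma Delta w).

Definition pp_constructs (R : realType) (sg sg' : signature)
    (C D : pointedType) (Gamma : valued_structure sg C)
    (Delta : valued_structure sg' D) : Prop :=
  exists d, (0 < d)%N /\
    exists P : valued_structure sg' ('I_d -> C),
      is_pp_power Gamma P /\ frac_hom_equiv R Delta P.

(** * The valued structures of the theorem *)

Definition binary_sig (tau : Type) : signature :=
  @Signature tau (fun=> 2%N).

Section Delta.
Variables (tau C : Type) (rC : structure tau C).

Definition Delta_rel (s : tau) : valued_rel C 2 :=
  fun t => if `[< rC s (t ord0) (t ord_max) >] then 0%E else 1%E.

Lemma Delta_rel_neqNy s t : Delta_rel s t != -oo%E.
Proof. by rewrite /Delta_rel; case: ifP. Qed.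

Definition Delta_of : valued_structure (binary_sig tau) C :=
  @ValuedStructure (binary_sig tau) C Delta_rel Delta_rel_neqNy.

End Delta.

(* false and true stand for 0 and 1. *)
Definition OIT (a b c : bool) : bool :=
  (a, b, c) \in [:: (false, false, true); (false, true, false);
                    (true, false, false)].

Definition OIT_sig : signature := @Signature unit (fun=> 3%N).

Definition OIT_rel : valued_rel bool 3 :=
  fun t => crisp (OIT (t (inord 0)) (t (inord 1)) (t (inord 2))).

Definition OIT_structure : valued_structure OIT_sig bool :=
  @ValuedStructure OIT_sig bool (fun=> OIT_rel)
    (fun _ _ => crisp_neqNy _).

(* Main.v *)
Require Import Defs.
From mathcomp Require Import all_boot all_order all_algebra.
From mathcomp Require Import all_classical all_reals all_analysis.
From mathcomp Require Import measurable_realfun.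
Set Implicit Arguments.
Unset Strict Implicit.
Unset Printing Implicit Defensive.
Import Order.TTheory GRing.Theory Num.Theory.
Local Open Scope classical_set_scope.
Local Open Scope ring_scope.

(** The structure C does not satisfy mu, so an assignment of the variables of mu
in C violates at least one atom; by weighting the atoms one can express, with
Opt, that exactly one atom is violated and that it belongs to a prescribed set.
Let e_0, e_1, e_2 be consecutive atoms of the cycle.  A copy of mu with these
three atoms prescribed puts an OIT constraint on the bits "e_i is violated"; a
copy with only two of them prescribed forces their bits to be opposite.  Gluing
nine copies along these atoms gives an OIT constraint between three bits that
are all read off at e_0.

It remains to realize the three solutions of OIT simultaneously by two fixed
tuples.  By self-join-freeness, the glued structure satisfies mu only if the
variables of mu can be lifted to it compatibly with the atoms, and along the
cycle such a lift closes up to a triangle in a small tripartite graph.  This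
graph is triangle-free, so the glued structure maps to the dual of mu, hence
to C. *)

(** * Fractional homomorphisms given by a single map *)

(** [F] is arbitrary: [g \o t] depends on finitely many coordinates, so the function is locally
    constant and all preimages are open. *)
Lemma measurable_fun_restriction (R : realType) (D : eqType) (C : pointedType)
    (n : nat) (t : 'I_n -> D) (F : ('I_n -> C) -> \bar R) :
  measurable_fun setT ((fun g => F (g \o t)) : borel_maps D C -> \bar R).
Proof.
move=> _ B mB; rewrite setTI; apply: sub_sigma_algebra => /=.
rewrite openE => g gB.
have near_eq (i : 'I_n) :
    nbhs (g : {ptws D -> discrete_topology C}) [set g' | g' (t i) = g (t i)].
  have := @proj_continuous D (fun=> discrete_topology C) (t i) g.
  by move=> /(_ [set g (t i)]); apply; exact: discrete_set1.
have := @filter_forall _ _ _ _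
  (nbhs_filter (g : {ptws D -> discrete_topology C})) near_eq.
apply: filterS => g' gg' /=; rewrite /preimage /=.
by rewrite (_ : g' \o t = g \o t) //; apply: funext => i; exact: gg'.
Qed.

Lemma frac_hom_of_hom (R : realType) (sg : signature) (D C : pointedType)
    (Delta : valued_structure sg D) (Gamma : valued_structure sg C)
    (g : D -> C) :
  (forall s t, (vrel Gamma s (g \o t) <= vrel Delta s t)%E) ->
  exists w, @is_frac_hom R sg D C Delta Gamma w.
Proof.
move=> gle; exists (dirac (g : borel_maps D C)) => s t X.
have mX : measurable_fun setT X.
  exact: (@measurable_fun_restriction R D C _ t (er_map ratr \o vrel Gamma s)).
have intE (f : borel_maps D C -> \bar R) : measurable_fun setT f ->
    (\int[dirac (g : borel_maps D C)]_h f h = f g)%E.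
  by move=> mf; rewrite integral_dirac // diracT mul1e.
split; last first.
  rewrite intE // /X; have := gle s t.
  case: (vrel Gamma s (g \o t)) (vrel_neqNy Gamma (g \o t)) => [x||] //= _;
    case: (vrel Delta s t) (vrel_neqNy Delta t) => [y||] //= _; rewrite ?leey //.
  by rewrite !lee_fin ler_rat.
right; rewrite intE; last exact: measurable_funeneg.
rewrite funenegE /X.
case: (vrel Gamma s (g \o t)) (vrel_neqNy Gamma (g \o t)) => [x||] //= _.
  by rewrite /maxe; case: ifP => _; rewrite ltry.
by rewrite max_r // ?ltry // leNye.
Qed.

(** * Crisp expressible relations *)

Section Expressibility.
Variables (sg : signature) (C : Type) (Gamma : valued_structure sg C).

Lemma sum_crisp (m : nat) (Q : 'I_m -> Prop) :
  (\sum_(j < m) crisp (Q j) = crisp (forall j, Q j))%E.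
Proof.
rewrite /crisp; case: asboolP => [allQ|nQ].
  by rewrite big1 // => j _; rewrite asboolT.
have [j nQj] : exists j, ~ Q j by apply/existsNP.
rewrite (bigD1 j) //= (asboolF nQj) addye //.
have : (0 <= \sum_(i < m | i != j) (if `[< Q i >] then 0 else +oo) :> \bar rat)%E.
  by apply: sume_ge0 => i _; case: asboolP.
by case: (\sum_(i < m | _) _)%E.
Qed.

Lemma expressible_crisp_forall (k m : nat) (l : 'I_m -> nat)
    (Q : forall j, ('I_(l j) -> C) -> Prop) (v : forall j, 'I_(l j) -> 'I_k) :
  (forall j, expressible Gamma (fun t => crisp (Q j t))) ->
  expressible Gamma (fun t : 'I_k -> C => crisp (forall j, Q j (t \o v j))).
Proof.
move=> exQ; have := ex_sum v exQ.
by under [fun _ => _]funext do rewrite sum_crisp.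
Qed.

Lemma expressible_crisp_exists (k m : nat) (Q : ('I_(k + m) -> C) -> Prop) :
  expressible Gamma (fun t => crisp (Q t)) ->
  expressible Gamma (fun x : 'I_k -> C =>
    crisp (exists y : 'I_m -> C, Q (cat_tuple_fun x y))).
Proof.
move=> exQ; apply: ex_proj exQ _ => x; split; first exact: crisp_neqNy.
split=> [_ [y _ <-]|b lb_b]; rewrite /crisp.
  case: (asboolP (Q _)) => [Qxy|_]; last exact: leey.
  by rewrite asboolT //; exists y.
case: (asboolP (ex _)) => [[y Qxy]|_]; last exact: leey.
by apply: lb_b; exists y => //; rewrite /crisp asboolT.
Qed.

End Expressibility.

(** * Assignments violating exactly one atom *)

Section Violations.
Variables (tau : finType) (mu : conj_query tau) (C : Type).
Variable rC : structure tau C.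
Local Notation V := (cq_var mu).
Local Notation atomT := (tau * V * V)%type.
Local Notation atoms := (cq_atoms mu).

Definition violated (a : atomT) (z : V -> C) : bool :=
  `[< ~ rC a.1.1 (z a.1.2) (z a.2) >].

Definition violates_exactly_one (H : pred atomT) (z : V -> C) : Prop :=
  exists a, [/\ a \in atoms, H a & {in atoms, forall b, violated b z = (b == a)}].

Definition violation_cost (H : pred atomT) (z : V -> C) : nat :=
  \sum_(a <- atoms) (if violated a z then (~~ H a).+1 else 0)%N.

Hypothesis sjf : self_join_free mu.

Lemma self_join_free_inj : {in atoms &, injective (fun a : atomT => a.1.1)}.
Proof.
move: sjf; rewrite /self_join_free; elim: atoms => //= a s IHs /andP[nas us].
move=> b c /[!inE] /predU1P[->|bs] /predU1P[->|cs] //; last exact: IHs.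
  by move=> ac; move: nas; rewrite ac (map_f (fun a : atomT => a.1.1)).
by move=> ba; move: nas; rewrite -ba (map_f (fun a : atomT => a.1.1)).
Qed.

Lemma violation_cost_eq1 (H : pred atomT) (z : V -> C) :
  violation_cost H z = 1%N <-> violates_exactly_one H z.
Proof.
have ua : uniq atoms := map_uniq sjf.
rewrite /violation_cost; split; last first.
  case=> a [aA Ha viol]; rewrite (bigD1_seq a) //= viol // eqxx Ha big_seq_cond.
  by rewrite big1 // => b /andP[bA /negPf ba]; rewrite viol // ba.
move=> cost1; have [/hasP[a aA va]|/hasPn nv] := boolP (has (violated^~ z) atoms).
  move: cost1; rewrite (bigD1_seq a) //= va addSn => -[] /eqP.
  rewrite addn_eq0 eqb0 negbK sum_nat_seq_eq0 => /andP[Ha /allP rest].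
  exists a; split=> // b bA; have [->|ba] := eqVneq b a; first exact: va.
  by have := rest _ bA; rewrite ba /=; case: violated.
by move: cost1; rewrite big_seq big1 // => a /nv /negPf ->.
Qed.

Hypothesis rC_unsat : ~ satisfies mu rC.

Lemma exists_violated (z : V -> C) : exists2 a, a \in atoms & violated a z.
Proof.
apply: contrapT => nv; apply: rC_unsat; exists z => s x y sxy.
by apply: contrapT => nr; apply: nv; exists (s, x, y) => //; apply/asboolP.
Qed.

Lemma violation_cost_gt0 (H : pred atomT) (z : V -> C) :
  (0 < violation_cost H z)%N.
Proof.
have [a aA va] := exists_violated z.
by rewrite /violation_cost (bigD1_seq a) ?(map_uniq sjf) //= va addSn.
Qed.

(* Violating an atom costs 1 inside H and 2 outside; as every assignment
   violates some atom, the optimal ones are those of cost 1. *)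
Lemma expressible_violates_exactly_one (H : pred atomT) :
  (exists z, violates_exactly_one H z) ->
  expressible (Delta_of rC) (fun t : 'I_#|V| -> C =>
    crisp (violates_exactly_one H (t \o enum_rank))).
Proof.
move=> [z0 /violation_cost_eq1 cost_z0].
pose a (j : 'I_(size atoms)) := tnth (in_tuple atoms) j.
pose S (j : 'I_(size atoms)) : valued_rel C 2 :=
  fun t => ((~~ H (a j)).+1%:R%:E * Delta_rel rC (a j).1.1 t)%E.
pose var (j : 'I_(size atoms)) (i : 'I_2) : 'I_#|V| :=
  enum_rank (if i == ord0 then (a j).1.2 else (a j).2).
have exS j : expressible (Delta_of rC) (S j).
  by apply: ex_scale; [exact: ler0n | exact: (ex_rel (Delta_of rC) (a j).1.1)].
have := ex_opt (@ex_sum _ _ (Delta_of rC) _ _ _ S var exS).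
have costE (t : 'I_#|V| -> C) : (\sum_(j < size atoms) S j (t \o var j) =
    (violation_cost H (t \o enum_rank))%:R%:E)%E.
  rewrite /violation_cost natr_sum -sumEFin [RHS]big_tnth.
  apply: eq_bigr => j _; rewrite /S /Delta_rel /violated asbool_neg /= -/(a j).
  by case: asboolP => _ /=; rewrite ?mule0 ?mule1.
congr expressible; apply: funext => t; congr crisp; apply: propext.
under eq_forall do rewrite !costE lee_fin ler_nat.
rewrite costE; split=> [[_ /(_ (z0 \o @enum_val _ V))]|one]; last first.
  split=> [|u]; first by rewrite ltry.
  by rewrite ((violation_cost_eq1 _ _).2 one) violation_cost_gt0.
rewrite (_ : (z0 \o @enum_val _ V) \o enum_rank = z0) ?cost_z0 => [le1|]; last first.
  by apply: funext => x /=; rewrite enum_rankK.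
apply/violation_cost_eq1/eqP; rewrite eqn_leq violation_cost_gt0 andbT.
exact: le1.
Qed.

End Violations.

(** * The finite gadget *)

(* A copy (l, h) of the query places its variables of type i (i < 3) at the
   position l_i.  The positions 0, 1, 2 are the arguments of OIT and 3, 4, 5
   are existentially quantified.  The copy must violate exactly one of the three
   distinguished atoms, and not the one numbered h (none is excluded if h = 3);
   the atom number i joins the types i and i + 1 modulo 3.  Hence the first copy
   relates three bits by OIT, and the two chains of four negations that follow
   transport the second and the third of them to the atom number 0 at the
   positions 1 and 2. *)
Definition gadget : seq (seq nat * nat) :=
  [:: ([:: 0; 0; 3], 3);
      ([:: 3; 0; 3], 2); ([:: 3; 0; 4], 2); ([:: 1; 0; 4], 0); ([:: 1; 1; 4], 1);
      ([:: 0; 2; 3], 0); ([:: 4; 2; 3], 2); ([:: 4; 2; 5], 2); ([:: 2; 2; 5], 2)]%N.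

Definition position (j l : nat) : nat := nth 0%N (nth ([::], 0%N) gadget j).1 l.
Definition hard_label (j : nat) : nat := (nth ([::], 0%N) gadget j).2.

(* Row i lists the atoms violated by the copies when the only true argument of
   OIT is the one at position 2 - i. *)
Definition violated_label (i j : nat) : nat :=
  nth 0%N (nth [::] [:: [:: 2; 0; 0; 2; 2; 2; 0; 0; 0];
                       [:: 1; 1; 1; 1; 0; 1; 1; 1; 1];
                       [:: 0; 0; 0; 2; 2; 1; 1; 1; 1]]%N i) j.

(* The three solutions of the gadget share the points 0 and 1, which represent
   the two Boolean values, and are otherwise disjoint. *)
Definition point (i p : nat) : nat :=
  if (p < 3)%N then nat_of_bool (p + i == 2)%N else (3 * i + p - 1)%N.

Definition next_label (l : nat) : nat := (l.+1 %% 3)%N.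

(** The part of the tripartite graph lying over the cycle atom [l]: an edge for each copy, in each
    of the three solutions, that has to satisfy this atom. *)
Definition gadget_edges (l : nat) : seq (nat * nat) :=
  [seq (point i (position j l), point i (position j (next_label l)))
     | i <- iota 0 3, j <- [seq j <- iota 0 9 | violated_label i j != l]].

Lemma gadget_triangle_free (x y z : nat) :
  (x, y) \in gadget_edges 0 -> (y, z) \in gadget_edges 1 ->
  (z, x) \in gadget_edges 2 -> False.
Proof.
have /allP/(_ (x, y)) check : all (fun p => all (fun q =>
    (q.1 == p.2) ==> ((q.2, p.1) \notin gadget_edges 2)) (gadget_edges 1))
    (gadget_edges 0) by vm_compute.
by move=> /check/allP/(_ (y, z)) /[apply]; rewrite eqxx /= => /negP.
Qed.

Lemma mem_gadget_edges (i j l : nat) : (i < 3)%N -> (j < 9)%N ->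
  violated_label i j != l ->
  (point i (position j l), point i (position j (next_label l)))
    \in gadget_edges l.
Proof.
move=> i3 j9 nv; apply/allpairsPdep; exists i, j; split=> //.
  by rewrite mem_iota.
by rewrite mem_filter nv mem_iota.
Qed.

Lemma point_position_lt (i j l : nat) : (i < 3)%N -> (j < 9)%N -> (l < 3)%N ->
  (point i (position j l) < 11)%N.
Proof.
move=> i3 j9 l3.
have /allP/(_ i) : all (fun i => all (fun j => all (fun l =>
    point i (position j l) < 11)%N (iota 0 3)) (iota 0 9)) (iota 0 3)
  by vm_compute.
by rewrite mem_iota => /(_ i3) /allP/(_ j); rewrite mem_iota => /(_ j9) /allP/(_ l);
  rewrite mem_iota; exact.
Qed.

Lemma violated_label_soft (i j : nat) : (i < 3)%N -> (j < 9)%N ->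
  (violated_label i j < 3)%N && (violated_label i j != hard_label j).
Proof.
move=> i3 j9.
have /allP/(_ i) : all (fun i => all (fun j => (violated_label i j < 3)%N &&
    (violated_label i j != hard_label j)) (iota 0 9)) (iota 0 3) by vm_compute.
by rewrite mem_iota => /(_ i3) /allP/(_ j); rewrite mem_iota; exact.
Qed.

(** * Indexing of blocks *)

Lemma block_index_subproof k d (i : 'I_k) (x : 'I_d) : (i * d + x < k * d)%N.
Proof.
rewrite (leq_trans (_ : _ < i.+1 * d)%N) ?leq_mul2r ?ltn_ord ?orbT //.
by rewrite mulSn addnC ltn_add2r.
Qed.

Definition block_index k d (i : 'I_k) (x : 'I_d) : 'I_(k * d) :=
  Ordinal (block_index_subproof i x).

Lemma flatten_block_index (C : Type) k d (t : 'I_k -> 'I_d -> C) i x :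
  flatten_blocks t (block_index i x) = t i x.
Proof.
have d0 : (0 < d)%N by exact: leq_ltn_trans (ltn_ord x).
rewrite /flatten_blocks; congr (t _ _); apply: val_inj => /=.
  by rewrite divnMDl // divn_small // addn0.
by rewrite modnMDl modn_small.
Qed.

Definition position_index d (p : nat) (x : 'I_d) : 'I_(3 * d + 3 * d) :=
  if (p < 3)%N then lshift _ (block_index (inord p : 'I_3) x)
  else rshift _ (block_index (inord (p - 3) : 'I_3) x).

Lemma cat_position_index (C : Type) d (t y : 'I_3 -> 'I_d -> C) p x :
  cat_tuple_fun (flatten_blocks t) (flatten_blocks y) (position_index p x) =
  if (p < 3)%N then t (inord p) x else y (inord (p - 3)) x.
Proof.
rewrite /cat_tuple_fun /position_index; case: ifP => _.
  by rewrite (unsplitK (inl _)) flatten_block_index.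
by rewrite (unsplitK (inr _)) flatten_block_index.
Qed.

(** * The gadget structure along the cycle *)

Section Cycle.
Variables (tau : finType) (mu : conj_query tau).
Local Notation V := (cq_var mu).
Local Notation atomT := (tau * V * V)%type.
Local Notation atoms := (cq_atoms mu).
Variables (k : nat) (v : nat -> mg_vertex (multigr mu))
  (e : nat -> mg_edge (multigr mu)).
Hypotheses (k_ge3 : (3 <= k)%N) (v_closed : v k = v 0%N)
  (v_inj : {in gtn k &, injective v}) (e_inj : {in gtn k &, injective e}).
Hypothesis e_ends : forall i, (i < k)%N ->
  mg_ends (e i) = finset.setU (finset.set1 (v i)) (finset.set1 (v i.+1)).
Hypothesis sjf : self_join_free mu.

Definition cycle_atom (i : nat) : atomT := ssval (e i).

Lemma cycle_atom_mem i : cycle_atom i \in atoms.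
Proof. exact: ssvalP. Qed.

Lemma cycle_atom_inj : {in gtn k &, injective cycle_atom}.
Proof. by move=> i j ik jk /val_inj; exact: e_inj. Qed.

Lemma cycle_atom_ends i : (i < k)%N ->
  ((cycle_atom i).1.2 = v i /\ (cycle_atom i).2 = v i.+1) \/
  ((cycle_atom i).1.2 = v i.+1 /\ (cycle_atom i).2 = v i).
Proof.
move=> /e_ends /= /setP E.
have := E (cycle_atom i).1.2; have := E (cycle_atom i).2.
have := E (v i); have := E (v i.+1).
rewrite !finset.inE !eqxx !orbT /= -/(cycle_atom i) => + + /esym + /esym.
do 4![case/orP=> /eqP ?]; do ?[by left; split; congruence].
all: by right; split; congruence.
Qed.

(* All vertices of the cycle but v 1 and v 2 have the same type, so a cycle of
   any length behaves like a triangle. *)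
Definition vtype (x : V) : nat :=
  if x == v 1 then 1%N else if x == v 2 then 2%N else 0%N.

Lemma vtype_lt3 x : (vtype x < 3)%N.
Proof. by rewrite /vtype; do 2?case: ifP. Qed.

Lemma vtype_cycle i : (i <= k)%N ->
  vtype (v i) = if (i < 3)%N then i else 0%N.
Proof.
rewrite leq_eqVlt => /predU1P[->|ik].
  rewrite ltnNge k_ge3 /= v_closed /vtype.
  by rewrite !(inj_in_eq v_inj) // inE ?(leq_trans _ k_ge3).
have k1 : (1 < k)%N by rewrite (leq_trans _ k_ge3).
rewrite /vtype !(inj_in_eq v_inj) //; by case: i ik => [|[|[|]]].
Qed.

Lemma vtype_next i : (i < 3)%N -> vtype (v i.+1) = next_label i.
Proof.
move=> i3; rewrite vtype_cycle ?(leq_trans i3) //.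
by case: i i3 => [|[|[|]]].
Qed.

Lemma vtype_ends i : (i < 3)%N ->
  (vtype (cycle_atom i).1.2 = i /\ vtype (cycle_atom i).2 = next_label i) \/
  (vtype (cycle_atom i).1.2 = next_label i /\ vtype (cycle_atom i).2 = i).
Proof.
move=> i3; have ik := leq_trans i3 k_ge3.
have vi : vtype (v i) = i by rewrite vtype_cycle ?i3 // ltnW.
by case: (cycle_atom_ends ik) => -[-> ->]; rewrite vi vtype_next //; [left|right].
Qed.

(** Two points are shared by the solutions and each has three of its own, whence 11. Reading both
    points off one [m] forces an atom between variables of equal type to keep the point; only the
    three distinguished atoms are restricted further. *)
Definition gadget_structure : structure tau (V * 'I_11) :=
  fun s p q => (s, p.1, q.1) \in atoms /\
    exists m : nat -> 'I_11,
      [/\ p.2 = m (vtype p.1), q.2 = m (vtype q.1) &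
        forall l, (l < 3)%N -> (s, p.1, q.1) = cycle_atom l ->
          (m l : nat, m (next_label l) : nat) \in gadget_edges l].

(* By self-join-freeness, a satisfying assignment h fixes the first components;
   the second components h2 (v 0), h2 (v 1), h2 (v 2) would form a triangle. *)
Lemma gadget_structure_unsat : ~ satisfies mu gadget_structure.
Proof.
case=> h h_hom; pose n i := (h (v i)).2.
have step i : (i < k)%N -> exists m : nat -> 'I_11,
    [/\ n i = m (vtype (v i)), n i.+1 = m (vtype (v i.+1)) &
      (i < 3)%N -> (m i : nat, m (next_label i) : nat) \in gadget_edges i].
  move=> ik; have aE : cycle_atom i =
      ((cycle_atom i).1.1, (cycle_atom i).1.2, (cycle_atom i).2).
    by case: cycle_atom => -[].
  have := cycle_atom_mem i; rewrite {1}aE => /h_hom[hA [m [m1 m2 mE]]].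
  have hE := self_join_free_inj sjf hA (cycle_atom_mem i) erefl.
  have h1 : (h (cycle_atom i).1.2).1 = _ := congr1 (fun a : atomT => a.1.2) hE.
  have h2 : (h (cycle_atom i).2).1 = _ := congr1 snd hE.
  rewrite h1 in m1; rewrite h2 in m2.
  exists m; split; last by move=> i3; apply: mE i3 hE.
    by rewrite /n; case: (cycle_atom_ends ik) => -[E1 E2];
      rewrite E1 E2 in m1 m2.
  by rewrite /n; case: (cycle_atom_ends ik) => -[E1 E2];
    rewrite E1 E2 in m1 m2.
have edge i : (i < 3)%N -> (n i : nat, n i.+1 : nat) \in gadget_edges i.
  move=> i3; have ik := leq_trans i3 k_ge3.
  have [m [-> -> /(_ i3)]] := step i ik.
  by rewrite vtype_next // vtype_cycle ?i3 // ltnW.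
(* The vertices [v 3], ..., [v k] all have type 0, so the point stays constant on the rest of the
   cycle. *)
have tail i : (3 + i <= k)%N -> n (3 + i)%N = n 3%N.
  elim: i => [|i IHi] ik; first by rewrite addn0.
  rewrite addnS in ik *; rewrite -IHi 1?ltnW //.
  have [m [-> -> _]] := step _ ik.
  by rewrite !vtype_cycle // ltnW.
have n3 : n 3%N = n 0%N.
  by rewrite -(tail (k - 3)%N) subnKC // /n v_closed.
have e2 := edge 2%N isT; rewrite n3 in e2.
exact: gadget_triangle_free (edge 0%N isT) (edge 1%N isT) e2.
Qed.

Definition soft_atom (j : nat) (a : atomT) : bool :=
  [exists l : 'I_3, (nat_of_ord l != hard_label j) && (a == cycle_atom l)].

(** * The gadget relation over the target *)

Section Target.
Variables (C : Type) (rC : structure tau C).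
Hypothesis rC_unsat : ~ satisfies mu rC.

(** All atoms but the one selected by [violated_label] hold in the gadget structure, hence in the
    target; that one must then fail, as the target does not satisfy the query. *)
Lemma gadget_copy_violates (f : V * 'I_11 -> C) (i j : nat) :
  is_hom gadget_structure rC f -> (i < 3)%N -> (j < 9)%N ->
  violates_exactly_one rC (soft_atom j)
    (fun x => f (x, inord (point i (position j (vtype x))))).
Proof.
move=> f_hom i3 j9; set z := fun x => _.
pose a := cycle_atom (violated_label i j).
have /andP[v3 vhard] := violated_label_soft i3 j9.
have sat b : b \in atoms -> b != a -> violated rC b z = false.
  case: b => [[s x] y] bA ba; rewrite /violated asbool_neg; apply/negbF/asboolP.
  apply: f_hom; split=> //=.
  exists (fun l => inord (point i (position j l))); split=> // l l3 bl.
  rewrite !inordK ?point_position_lt ?ltn_pmod //.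
  by apply: mem_gadget_edges => //; apply: contraNneq ba => E; rewrite bl /a E.
exists a; split; first exact: cycle_atom_mem.
  by apply/existsP; exists (Ordinal v3); rewrite /= vhard eqxx.
move=> b bA; have [->|ba] := eqVneq b a; last exact: sat.
have [c cA vc] := exists_violated rC_unsat z.
by have [<-//|/(sat _ cA)] := eqVneq c a; rewrite vc.
Qed.

Definition copy_var (j : nat) (i : 'I_#|V|) : 'I_(3 * #|V| + 3 * #|V|) :=
  position_index (position j (vtype (enum_val i))) i.

Definition gadget_holds (T : 'I_(3 * #|V|) -> C) : Prop :=
  exists Y : 'I_(3 * #|V|) -> C, forall j : 'I_9,
    violates_exactly_one rC (soft_atom j)
      ((cat_tuple_fun T Y \o copy_var j) \o enum_rank).

Definition tuple_bit (a : 'I_#|V| -> C) : bool :=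
  violated rC (cycle_atom 0) (a \o enum_rank).

Lemma gadget_holds_OIT (t : 'I_3 -> 'I_#|V| -> C) :
  gadget_holds (flatten_blocks t) ->
  OIT (tuple_bit (t (inord 0))) (tuple_bit (t (inord 1)))
    (tuple_bit (t (inord 2))).
Proof.
case=> Y vY; pose bit p := tuple_bit (t (inord p)).
rewrite -!/(bit _).
pose Z p x := cat_tuple_fun (flatten_blocks t) Y (position_index p (enum_rank x)).
(* The ends of the cycle atom [l] have types [l] and [next_label l], so copies that agree on these
   two positions share the bit of this atom. *)
pose edge l p q := violated rC (cycle_atom l)
  (fun x => Z (if vtype x == l then p else q) x).
have next_neq l : (l < 3)%N -> (next_label l == l) = false.
  by case: l => [|[|[|]]].
have copyE j l : (l < 3)%N ->
    violated rC (cycle_atom l) (fun x => Z (position j (vtype x)) x) =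
    edge l (position j l) (position j (next_label l)).
  move=> l3; rewrite /edge /violated.
  by case: (vtype_ends l3) => -[-> ->]; rewrite eqxx next_neq.
have bitE p : (p < 3)%N -> bit p = edge 0%N p p.
  move=> p3; rewrite /bit /tuple_bit /edge; congr violated; apply: funext => x.
  rewrite if_same /Z /cat_tuple_fun /position_index p3 /=.
  by rewrite (unsplitK (inl _)) flatten_block_index.
have exact_one j : (j < 9)%N -> exists2 l0, (l0 < 3)%N && (l0 != hard_label j) &
    forall l, (l < 3)%N ->
      edge l (position j l) (position j (next_label l)) = (l == l0).
  move=> j9; have [a [aA /existsP[l0 /andP[l0h /eqP aE]] va]] := vY (Ordinal j9).
  exists l0; first by rewrite ltn_ord l0h.
  move=> l l3; rewrite -copyE //.
  have -> : (fun x => Z (position j (vtype x)) x) =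
      (cat_tuple_fun (flatten_blocks t) Y \o copy_var j) \o enum_rank.
    by apply: funext => x; rewrite /Z /= /copy_var enum_rankK.
  rewrite (va _ (cycle_atom_mem l)) aE.
  by rewrite (inj_in_eq cycle_atom_inj) // inE ?(leq_trans _ k_ge3).
have neg j l l' : (j < 9)%N -> (l < 3)%N -> (l' < 3)%N ->
    l != l' -> l != hard_label j -> l' != hard_label j -> (hard_label j < 3)%N ->
    edge l' (position j l') (position j (next_label l')) =
    ~~ edge l (position j l) (position j (next_label l)).
  move=> /exact_one[l0 /andP[l03 l0h] E] l3 l'3; rewrite !E //.
  move: (hard_label j) l0h => h.
  by case: h => [|[|[|]]] //; case: l0 l03 {E} => [|[|[|]]] //;
     case: l l3 => [|[|[|]]] //; case: l' l'3 => [|[|[|]]].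
(* Consecutive copies of the chain share an atom, and the four negations cancel. *)
have q : bit 1%N = edge 1%N 0%N 3%N.
  rewrite bitE // (neg 4%N 2%N 0%N) // [edge _ _ _](neg 3%N 1%N 2%N) //.
  by rewrite [edge _ _ _](neg 2%N 0%N 1%N) // [edge _ _ _](neg 1%N 1%N 0%N) // !negbK.
have r : bit 2%N = edge 2%N 3%N 0%N.
  rewrite bitE // (neg 8%N 1%N 0%N) // [edge _ _ _](neg 7%N 0%N 1%N) //.
  by rewrite [edge _ _ _](neg 6%N 1%N 0%N) // [edge _ _ _](neg 5%N 2%N 1%N) // !negbK.
rewrite bitE // q r; have [l0 /andP[l03 _] E] := exact_one 0%N isT.
rewrite [edge 0%N _ _](E 0%N) // [edge 1%N _ _](E 1%N) // [edge 2%N _ _](E 2%N) //.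
by case: l0 l03 {E} => [|[|[|]]].
Qed.

(** The points 0 and 1 belong to all three solutions, so their images under [f] encode the two
    Boolean values in each; only the existential witnesses vary with the solution. *)
Lemma OIT_gadget_holds (f : V * 'I_11 -> C) (b : 'I_3 -> bool) :
  is_hom gadget_structure rC f ->
  OIT (b (inord 0)) (b (inord 1)) (b (inord 2)) ->
  gadget_holds (flatten_blocks
    (fun p x => f (enum_val x, inord (nat_of_bool (b p))))).
Proof.
move=> f_hom oit.
have [i i3 bE] : exists2 i, (i < 3)%N &
    forall p, (p < 3)%N -> b (inord p) = (p + i == 2)%N.
  move: oit; rewrite /OIT !inE => /or3P[] /eqP[b0 b1 b2];
    [exists 0%N|exists 1%N|exists 2%N] => // -[|[|[|]]] //.
exists (flatten_blocks (fun p x => f (enum_val x, inord (point i (3 + p))))) => j.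
have := gadget_copy_violates f_hom i3 (ltn_ord j).
congr violates_exactly_one; apply: funext => x.
rewrite /= /copy_var cat_position_index !enum_rankK /point.
have : (position j (vtype x) < 6)%N.
  have /allP/(_ (nat_of_ord j)) : all (fun j => all (fun l =>
      position j l < 6)%N (iota 0 3)) (iota 0 9) by vm_compute.
  by rewrite mem_iota => /(_ (ltn_ord j)) /allP; apply; rewrite mem_iota vtype_lt3.
case: ifP => [p3 _|/negbT p3 p6]; first by rewrite bE.
rewrite -leqNgt in p3; rewrite inordK ?subnKC // ?ltn_subLR //.
by rewrite ltnNge p3.
Qed.

End Target.
End Cycle.

(** * The pp-construction *)

Theorem theorem41 (R : realType) (tau : finType) (mu : conj_query tau)
    (C : pointedType) (rC : structure tau C) :
  cq_connected mu ->
  self_join_free mu ->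
  (exists k : nat, (3 <= k)%N /\ has_cycle (multigr mu) k) ->
  is_C_mu mu rC ->
  pp_constructs R (Delta_of rC) OIT_structure.
Proof.
move=> _ sjf [k [k3 [v [e [vk v_inj e_inj e_ends]]]]].
move=> [_ _ [D [rD [_ _ dualD [[hCD homCD] [hDC homDC]]]]]].
have rC_unsat : ~ satisfies mu rC.
  case=> z zP; have [+ _] := dualD _ (canonical_db (mu := mu)); apply.
    by exists (hCD \o z) => s x y sxy; apply/homCD/zP.
  by exists id.
have [f f_hom] : exists f, is_hom (gadget_structure v e) rC f.
  have [_ [|g g_hom]] := dualD _ (gadget_structure v e).
    exact: (gadget_structure_unsat k3 vk v_inj e_ends sjf).
  by exists (hDC \o g) => s x y sxy; apply/homDC/g_hom.
set n := #|cq_var mu|.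
have n_gt0 : (0 < n)%N by apply/card_gt0P; exists (v 0%N).
exists n; split=> //.
pose S (T : 'I_(3 * n) -> C) := crisp (gadget_holds v e rC T).
have exS : expressible (Delta_of rC) S.
  apply: (@expressible_crisp_exists _ _ _ (3 * n) (3 * n) (fun T =>
    forall j : 'I_9, violates_exactly_one rC (soft_atom e j)
      ((T \o copy_var v j) \o enum_rank))).
  apply: (@expressible_crisp_forall _ _ _ _ 9 (fun=> n)
    (fun j t => violates_exactly_one rC (soft_atom e j) (t \o enum_rank))
    (fun j => copy_var v j)) => j.
  apply: expressible_violates_exactly_one => //.
  (* [Opt] selects the cost 1 only if it is attained; any solution of the gadget attains it, here
     the one of index 0. *)
  exists (fun x => f (x, inord (point 0 (position j (vtype v x))))).
  exact: gadget_copy_violates.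
exists (@ValuedStructure OIT_sig ('I_n -> C) (fun _ t => S (flatten_blocks t))
  (fun _ _ => crisp_neqNy _)); split; first by move=> s; exists S.
have crisp_le (P Q : Prop) : (P -> Q) -> (crisp Q <= crisp P)%E.
  move=> PQ; rewrite /crisp; case: (asboolP P) => [/PQ/asboolT ->//|_].
  exact: leey.
split.
  apply: (@frac_hom_of_hom R OIT_sig bool ('I_n -> C) _ _
    (fun (b : bool) x => f (enum_val x, inord (nat_of_bool b)))) => s t /=.
  by apply: crisp_le; exact: OIT_gadget_holds.
apply: (@frac_hom_of_hom R OIT_sig ('I_n -> C) bool _ _
  (tuple_bit e rC)) => s t /=.
apply: crisp_le; exact: (gadget_holds_OIT k3 vk v_inj e_inj e_ends).
Qed.
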